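(* Let $k\ge1$ and let $q$ be a prime power. The number of nondegenerate $2\times(k+1)\times k$ hypermatrices over $\mathbb F_q$ respecting $\Delta$ is $$q^{k^2}(q-1)^{2k}.$$
   Context: A $2\times(k+1)\times k$ hypermatrix over a field $\mathbb{F}$ is an array $M=(M_{h,i,j})$ with entries in $\mathbb F$, $1\le h\le 2$, $1\le i\le k+1$, $1\le j\le k$; it is viewed as the pair $(M_1,M_2)$ of $(k+1)\times k$ matrices $(M_h)_{i,j}=M_{h,i,j}$. It is nondegenerate if its (Cayley / Gelfand–Kapranov–Zelevinsky) hyperdeterminant is nonzero; for this format this is known to be equivalent to the condition, which may be taken as the definition, that $c_1M_1+c_2M_2$ has full rank $k$ for all $(c_1,c_2)\neq(0,0)$ in $\overline{\mathbb F}^2$, where $\overline{\mathbb F}$ is the algebraic closure. $\Delta=\langle\lambda,\mu\rangle$ is the plane partition with $\lambda_j=k+1-j$ and $\mu_j=k-j$ for $1\le j\le k$. A hypermatrix $M$ respects a plane partition $\langle\lambda,\mu\rangle$ if $M_{1,i,j}=0$ whenever $i>k+1-\lambda_j$ and $M_{2,i,j}=0$ whenever $i>k+1-\mu_j$. Thus $M$ respects $\Delta$ iff $M_{1,i,j}=0$ whenever $i>j$ and $M_{2,i,j}=0$ whenever $i>j+1$. *)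

(* Defs.v *)
From mathcomp Require Import all_boot all_order all_algebra.
From mathcomp Require Import boolp.

Set Implicit Arguments.
Unset Strict Implicit.
Unset Printing Implicit Defensive.

Import GRing.Theory.
Local Open Scope ring_scope.

(* M h is the slice M_(h+1): all indices are 0-based, so M h i j is the entry
   M_(h+1, i+1, j+1) of the mathematical text. *)
Definition hypermatrix (F : Type) (k : nat) : predArgType :=
  {ffun 'I_2 -> 'M[F]_(k.+1, k)}.

(* iota embeds F into an algebraic closure K.  For the 2 x (k+1) x k format
   this full-rank condition is equivalent to the nonvanishing of the
   hyperdeterminant.  The explicit %R matters: \rank opens scope %MS, where +
   is the sum of row spaces. *)
Definition hm_nondegenerate (F : fieldType) (K : closedFieldType)
    (iota : {rmorphism F -> K}) (k : nat) (M : hypermatrix F k) : Prop :=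
  forall c1 c2 : K, (c1, c2) != (0, 0) ->
    \rank (c1 *: map_mx iota (M ord0) + c2 *: map_mx iota (M ord_max))%R = k.

(* lambda j and mu j are the parts lambda_(j+1) and mu_(j+1); the 1-based row
   index is i.+1. *)
Definition respects (F : fieldType) (k : nat) (lambda mu : 'I_k -> nat)
    (M : hypermatrix F k) : bool :=
  [forall i : 'I_k.+1, forall j : 'I_k,
     ((k.+1 - lambda j < i.+1)%N ==> (M ord0 i j == 0)) &&
     ((k.+1 - mu j < i.+1)%N ==> (M ord_max i j == 0))].

(* Delta = <Delta_lambda, Delta_mu>, with 1-based part index j.+1. *)
Definition Delta_lambda (k : nat) (j : 'I_k) : nat := (k.+1 - j.+1)%N.
Definition Delta_mu (k : nat) (j : 'I_k) : nat := (k - j.+1)%N.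

Lemma respects_DeltaP (F : fieldType) (k : nat) (M : hypermatrix F k) :
  reflect (forall (i : 'I_k.+1) (j : 'I_k),
             ((j < i)%N -> M ord0 i j = 0) /\
             ((j.+1 < i)%N -> M ord_max i j = 0))
          (respects (@Delta_lambda k) (@Delta_mu k) M).
Proof.
have E1 (j : 'I_k) : (k.+1 - Delta_lambda j = j.+1)%N.
  by rewrite /Delta_lambda subKn // ltnS ltnW.
have E2 (j : 'I_k) : (k.+1 - Delta_mu j = j.+2)%N.
  by rewrite /Delta_mu subSn ?leq_subr // subKn.
apply: (iffP 'forall_forallP) => H i j; have := H i j; rewrite E1 E2 !ltnS.
  by move=> /andP[/implyP h1 /implyP h2]; split=> [/h1|/h2] /eqP.
by move=> [h1 h2]; apply/andP; split; apply/implyP; [move/h1 | move/h2] => ->.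
Qed.

(* Main.v *)
Require Import Defs.
From mathcomp Require Import all_boot all_order all_algebra.
From mathcomp Require Import boolp.
From mathcomp Require Import zify.

Set Implicit Arguments.
Unset Strict Implicit.
Unset Printing Implicit Defensive.

Import GRing.Theory.
Local Open Scope ring_scope.

(** A hypermatrix respecting Delta is nondegenerate iff all the entries
    M_{1,j,j} and M_{2,j+1,j} are nonzero.  If they are, then c_1 M_1 + c_2 M_2
    contains a k x k triangular minor with nonzero diagonal: the subdiagonal one
    if c_2 <> 0, the diagonal one if c_2 = 0.  Conversely, (c_1,c_2) = (1,0)
    forces the diagonal of M_1 to be nonzero; and if M_{2,j+1,j} = 0, then for
    every c the first j columns of c_1 M_1 + c_2 M_2 live in the first j rows,
    and the j x j pencil they form has a singular member over an algebraically
    closed field.  Hence 2k entries are nonzero and the remaining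
    sum_j (2j - 1) = k^2 entries are free. *)


(** The offset [d] lets one predicate serve both slices: [d = 0] for M_1 and [d = 1] for M_2. The
    nested [if] constrains each entry separately, which is the form that [card_mx_entrywise]
    counts. *)
Definition staircase (F : fieldType) (m n d : nat) (A : 'M[F]_(m, n)) : bool :=
  [forall i : 'I_m, forall j : 'I_n,
     if (i < j + d)%N then true
     else if i == (j + d)%N :> nat then A i j != 0 else A i j == 0].

Lemma staircaseP (F : fieldType) (m n d : nat) (A : 'M[F]_(m, n)) :
  reflect (forall (i : 'I_m) (j : 'I_n),
             (i = (j + d)%N :> nat -> A i j != 0) /\
             ((j + d < i)%N -> A i j = 0))
          (staircase d A).
Proof.
apply: (iffP 'forall_forallP) => H i j; have := H i j.
  case: ltngtP => [lt _|gt /eqP|eq] //; split=> // eq.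
    by rewrite eq ltnn in lt.
  by rewrite eq ltnn in gt.
by case: ltngtP => // [lt|eq] [h1 h2]; [rewrite h2 | apply: h1].
Qed.

Section CountMatrices.
Local Open Scope nat_scope.

(** A matrix is a function on index pairs, so independent conditions on its entries cut out a
    [family], whose cardinal is a product. *)
Lemma card_mx_entrywise (T : finType) (m n : nat)
    (P : 'I_m -> 'I_n -> pred T) :
  #|[pred A : 'M[T]_(m, n) | [forall i, forall j, P i j (A i j)]]|
  = \prod_(j < n) \prod_(i < m) #|P i j|.
Proof.
pose G (x : 'I_m * 'I_n) : pred T := P x.1 x.2.
have -> : \prod_(j < n) \prod_(i < m) #|P i j| = #|family G|.
  rewrite card_family foldrE big_image exchange_big /=.
  by rewrite (pair_bigA _ (fun i j => #|P i j|)).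
pose f (A : 'M[T]_(m, n)) : {ffun 'I_m * 'I_n -> T} := [ffun x => A x.1 x.2].
have f_inj : injective f.
  move=> A B /ffunP eqAB; apply/matrixP => i j.
  by have := eqAB (i, j); rewrite !ffunE.
rewrite -(card_image f_inj); apply: eq_card => g.
apply/imageP/familyP => [[A /'forall_forallP PA ->] [i j]|Pg].
  by rewrite ffunE; apply: PA.
exists (\matrix_(i, j) g (i, j)).
  by apply/'forall_forallP => i j; rewrite mxE; apply: (Pg (i, j)).
by apply/ffunP => -[i j]; rewrite ffunE mxE.
Qed.

Lemma prod_staircase_column (m c a b : nat) : c < m ->
  \prod_(i < m) (if i < c then a else if i == c :> nat then b else 1)
  = a ^ c * b.
Proof.
move=> lt_cm; pose w i := if i < c then a else if i == c then b else 1.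
rewrite -(big_mkord xpredT w) (big_cat_nat (n := c)) //=; last exact: ltnW.
congr (_ * _).
  rewrite (eq_big_nat _ _ (F2 := fun=> a)) => [|i /andP[_ lt_ic]].
    by rewrite prod_nat_const_nat subn0.
  by rewrite /w lt_ic.
rewrite big_ltn // /w ltnn eqxx big_nat_cond big1 ?muln1 // => i.
by case/andP=> /andP[lt_ci _] _; case: ltngtP lt_ci.
Qed.

Lemma card_staircase (F : finFieldType) (m n d : nat) : d + n <= m ->
  #|[pred A : 'M[F]_(m, n) | staircase d A]|
  = \prod_(j < n) (#|F| ^ (j + d) * (#|F| - 1)).
Proof.
move=> le_m; rewrite (card_mx_entrywise
  (fun i j x => if i < j + d then true
                else if i == j + d :> nat then x != 0%R else x == 0%R)).
(* Since d + n <= m, row [j + d] exists, so each column does contain its entry required to be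
   nonzero. *)
apply: eq_bigr => j _; rewrite -(@prod_staircase_column m (j + d)); last first.
  by rewrite addnC (leq_trans _ le_m) // ltn_add2l.
apply: eq_bigr => i _; case: ltngtP => _; first exact: eq_card.
  exact: card1.
by rewrite subn1; apply: cardC1.
Qed.

End CountMatrices.

Section Rank.
Variable F : fieldType.

Lemma det_upper_triangular (n : nat) (A : 'M[F]_n) :
  (forall i j : 'I_n, (j < i)%N -> A i j = 0) -> \det A = \prod_i A i i.
Proof.
move=> A0; rewrite -det_tr det_trig => [|]; last first.
  by apply/is_trig_mxP => i j lt_ij; rewrite mxE A0.
by apply: eq_bigr => i _; rewrite mxE.
Qed.

Lemma mxrank_rowsub_unit (m n : nat) (f : 'I_n -> 'I_m) (A : 'M[F]_(m, n)) :
  rowsub f A \in unitmx -> \rank A = n.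
Proof.
move=> uA; apply/eqP; rewrite eqn_leq rank_leq_col -{1}(mxrank_unit uA).
by rewrite -[A in rowsub f A]mul1mx -mul_rowsub_mx mxrankM_maxr.
Qed.

(** The [n] consecutive rows starting at row [d] form an upper triangular block with nonzero
    diagonal. *)
Lemma staircase_mxrank (m n d : nat) (A : 'M[F]_(m, n)) :
  (d + n <= m)%N -> staircase d A -> \rank A = n.
Proof.
move=> le_m /staircaseP sA.
have lt_m (i : 'I_n) : (i + d < m)%N.
  by rewrite addnC (leq_trans _ le_m) // ltn_add2l.
apply: (@mxrank_rowsub_unit _ _ (fun i => Ordinal (lt_m i))).
rewrite unitmxE unitfE det_upper_triangular => [|i j lt_ji].
  by apply/prodf_neq0 => i _; rewrite mxE (sA _ _).1.
by rewrite mxE (sA _ _).2 //= ltn_add2r.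
Qed.

(* A kernel vector of a singular leading block, extended by zero, is killed by
   the whole matrix. *)
Lemma det_leading_block (m n r : nat) (le_rm : (r <= m)%N) (le_rn : (r <= n)%N)
    (A : 'M[F]_(m, n)) :
  (forall (i : 'I_m) (j : 'I_n), (j < r)%N -> (r <= i)%N -> A i j = 0) ->
  \rank A = n -> \det (mxsub (widen_ord le_rm) (widen_ord le_rn) A) != 0.
Proof.
move=> A0 rkA; rewrite -det_tr; apply/negP => /det0P [w w_neq0 wB].
have At_free : row_free A^T by rewrite /row_free mxrank_tr rkA.
case/eqP: w_neq0; set g := widen_ord le_rn in wB *.
(* Multiplying by [rowsub g 1%:M], the first [r] rows of the identity, pads [w] with zeros. *)
have/eqP : w *m rowsub g 1%:M *m A^T = 0.
  rewrite -mulmxA mul_rowsub_mx mul1mx; apply/rowP => i; rewrite !mxE.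
  have [lt_ir|le_ri] := ltnP i r.
    move/rowP/(_ (Ordinal lt_ir)): wB; rewrite !mxE => wB.
    rewrite -[RHS]wB; apply: eq_bigr => j _; rewrite !mxE.
    by congr (_ * A _ _); apply: val_inj.
  by rewrite big1 // => j _; rewrite !mxE A0 ?mulr0 //=.
rewrite mulmx_free_eq0 // => /eqP/rowP w0; apply/rowP => j.
have := w0 (g j); rewrite !mxE (bigD1 j) //= big1 => [|i neq_ij].
  by rewrite !mxE eqxx mulr1 addr0.
rewrite !mxE [_ == _](_ : _ = false) ?mulr0 //.
by apply: contraNF neq_ij => /eqP/(congr1 val) /= /val_inj ->.
Qed.

End Rank.

(** Either A is singular, or B - aA is singular for any eigenvalue a of B A^-1; one exists because
    the characteristic polynomial has degree n > 0. *)
Lemma singular_pencil_member (K : closedFieldType) (n : nat) (A B : 'M[K]_n) :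
  (0 < n)%N -> exists c1 c2 : K,
    (c1, c2) != (0, 0) /\ \det (c1 *: A + c2 *: B) = 0.
Proof.
move=> n_gt0; have [detA0|] := eqVneq (\det A) 0.
  exists 1, 0; rewrite scale1r scale0r addr0; split=> //.
  by rewrite xpair_eqE oner_eq0.
rewrite -unitfE -unitmxE => uA.
have [a] : exists a, root (char_poly (B *m invmx A)) a.
  by apply/closed_rootP; rewrite size_char_poly eqSS -lt0n.
rewrite -eigenvalue_root_char => /eigenvalueP [v vBA v_neq0].
exists (- a), 1; split; first by rewrite xpair_eqE oner_eq0 andbF.
apply/eqP/det0P; exists v => //.
have vB : v *m B = a *: (v *m A) by rewrite scalemxAl -vBA mulmxA mulmxKV.
by rewrite mulmxDr -!scalemxAr scale1r vB scaleNr addNr.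
Qed.

Section Nondegenerate.
Variables (F : fieldType) (K : closedFieldType) (iota : {rmorphism F -> K}).
Variable k : nat.
Implicit Type M : hypermatrix F k.

Lemma staircase_nondegenerate M :
  staircase 0 (M ord0) -> staircase 1 (M ord_max) -> hm_nondegenerate iota M.
Proof.
move=> /staircaseP s0 /staircaseP s1 c1 c2 c_neq0.
have [c2_0|c2_neq0] := eqVneq c2 0.
  have c1_neq0 : c1 != 0 by move: c_neq0; rewrite c2_0 xpair_eqE eqxx andbT.
  apply: (@staircase_mxrank _ _ _ 0) => //; apply/staircaseP => i j.
  rewrite c2_0 scale0r addr0 !mxE mulf_eq0 (negPf c1_neq0) fmorph_eq0.
  by split=> [/(s0 i j).1|/(s0 i j).2 ->] //; rewrite rmorph0 mulr0.
apply: (@staircase_mxrank _ _ _ 1) => //; apply/staircaseP => i j.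
rewrite !mxE; split=> lt_ij.
  rewrite (s0 i j).2 ?lt_ij ?addn0 ?addn1 // rmorph0 mulr0 add0r.
  by rewrite mulf_eq0 (negPf c2_neq0) fmorph_eq0 (s1 i j).1.
rewrite (s0 i j).2 ?(s1 i j).2 ?rmorph0 ?mulr0 ?addr0 //.
by rewrite (leq_ltn_trans _ lt_ij) // leq_add2l.
Qed.

Lemma nondegenerate_staircase M :
  respects (@Delta_lambda k) (@Delta_mu k) M -> hm_nondegenerate iota M ->
  staircase 0 (M ord0) && staircase 1 (M ord_max).
Proof.
move=> /respects_DeltaP rM ndM.
have M0 (i : 'I_k.+1) (j : 'I_k) : (j < i)%N -> M ord0 i j = 0.
  by case: (rM i j).
have M1 (i : 'I_k.+1) (j : 'I_k) : (j.+1 < i)%N -> M ord_max i j = 0.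
  by case: (rM i j).
apply/andP; split; apply/staircaseP => i j.
  rewrite addn0; split=> [eq_ij|]; last exact: M0.
  have rk0 : \rank (M ord0) = k.
    have := ndM 1 0; rewrite scale1r scale0r addr0 mxrank_map; apply.
    by rewrite xpair_eqE oner_eq0.
  have A0 (i' : 'I_k.+1) (j' : 'I_k) :
      (j' < k)%N -> (k <= i')%N -> M ord0 i' j' = 0.
    by move=> lt_j' /(leq_trans lt_j')/M0.
  (* The top k x k block of M_1 is upper triangular, so its determinant is the product of the
     diagonal entries. *)
  have := det_leading_block (leqnSn k) (leqnn k) A0 rk0.
  rewrite det_upper_triangular => [/prodf_neq0/(_ j isT)|a b lt_ba].
    by rewrite mxE; congr (M _ _ _ != 0); apply: val_inj.
  by rewrite mxE M0.
rewrite addn1; split=> [eq_ij|]; last exact: M1.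
apply/negP => /eqP Mij0.
pose A := map_mx iota (M ord0); pose B := map_mx iota (M ord_max).
(* As [j] is 0-based, the block has size [j.+1] and is never empty. *)
pose f := widen_ord (leqW (ltn_ord j)); pose g := widen_ord (ltn_ord j).
have [c1 [c2 [c_neq0 det0]]] :=
  singular_pencil_member (mxsub f g A) (mxsub f g B) isT.
have C0 (i' : 'I_k.+1) (j' : 'I_k) : (j' < j.+1)%N -> (j.+1 <= i')%N ->
    (c1 *: A + c2 *: B) i' j' = 0.
  move=> lt_j' le_i'; rewrite !mxE M0 ?(leq_trans lt_j') // rmorph0 mulr0 add0r.
  (* Below the block, the only entry of M_2 not already zero by shape is the one at [i], [j], which
     is zero by assumption. *)
  have [lt_i'|ge_i'] := ltnP j'.+1 i'; first by rewrite M1 // rmorph0 mulr0.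
  have eq_j' : j' = j.
    by apply/val_inj/eqP; rewrite eqn_leq -ltnS lt_j' -ltnS (leq_trans le_i').
  have -> : i' = i.
    apply/val_inj/eqP; rewrite /= eq_ij eqn_leq le_i' andbT -eq_j'.
    exact: ge_i'.
  by rewrite eq_j' Mij0 rmorph0 mulr0.
have := det_leading_block (leqW (ltn_ord j)) (ltn_ord j) C0 (ndM c1 c2 c_neq0).
by rewrite linearD !linearZ /= det0 eqxx.
Qed.

Lemma nondegenerate_DeltaE M :
  respects (@Delta_lambda k) (@Delta_mu k) M && `[< hm_nondegenerate iota M >]
  = staircase 0 (M ord0) && staircase 1 (M ord_max).
Proof.
apply/andP/idP => [[rM /asboolP]|/andP[s0 s1]].
  exact: nondegenerate_staircase.
split; last by apply/asboolP; apply: staircase_nondegenerate.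
apply/respects_DeltaP => i j; move/staircaseP/(_ i j): s0 => [_].
by move/staircaseP/(_ i j): s1 => [_]; rewrite addn0 addn1.
Qed.

End Nondegenerate.

Theorem theorem3p8 (k : nat) (hk : (1 <= k)%N)
    (q p e : nat) (hp : prime p) (he : (1 <= e)%N) (hq : q = (p ^ e)%N)
    (F : finFieldType) (hF : #|F| = q)
    (K : closedFieldType) (iota : {rmorphism F -> K})
    (hK : integralRange iota) :
  #|[set M : hypermatrix F k |
       respects (@Delta_lambda k) (@Delta_mu k) M
         && `[< hm_nondegenerate iota M >]]|
  = (q ^ (k ^ 2) * (q - 1) ^ (2 * k))%N.
Proof.
(* The slice index, read as a number, is the staircase offset of that slice. *)
pose P (h : 'I_2) := [pred A : 'M[F]_(k.+1, k) | staircase h A].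
have -> : #|[set M : hypermatrix F k |
       respects (@Delta_lambda k) (@Delta_mu k) M
         && `[< hm_nondegenerate iota M >]]| = #|family P|.
  apply: eq_card => M; rewrite inE nondegenerate_DeltaE.
  apply/andP/familyP => [[s0 s1] h|sM]; last first.
    by split; [apply: (sM ord0) | apply: (sM ord_max)].
  have [->|->] // : h = ord0 \/ h = ord_max.
  by case: h => [[|[|//]] lt_h]; [left | right]; apply: val_inj.
rewrite card_family foldrE big_image big_ord_recl big_ord1 /=.
rewrite !card_staircase //= hF -big_split /=.
(* Column [j] of the two slices together contributes q^(2j+1) (q-1)^2, and the odd numbers 2j+1 with
   j < k sum to k^2. *)
elim: k {hk P} => [|k IHk]; first by rewrite big_ord0 muln0.
rewrite big_ord_recr IHk /= [(q ^ (k + 0) * _ * _)%N]mulnACA mulnACA.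
rewrite -!expnD mulnn -expnD; congr (q ^ _ * _ ^ _)%N.
  by rewrite /bump /= -!mulnn; lia.
by rewrite mulnS addnC.
Qed.
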